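(* Let $V$ be a countable set, and let $E$ and $F$ be objects of $\mathcal G(V)$, i.e. directed graphs with vertex set $V$. Let $\Gamma\colon\mathcal G(V)\to\mathcal C_0(V)$ be the graph-correspondence functor. (i) If $\Gamma(E)=\Gamma(F)$ in $\mathcal C_0(V)$, then $E=F$ in $\mathcal G(V)$. (ii) If $\phi\colon E\to F$ is a morphism in $\mathcal G(V)$ such that $\Gamma(\phi)\colon\Gamma(E)\to\Gamma(F)$ is an isomorphism in $\mathcal C_0(V)$, then $\phi$ is an isomorphism in $\mathcal G(V)$.
   Context: $V$ is a countable set regarded as a discrete space, and $c_0(V)$ is the $C^*$-algebra of complex functions on $V$ vanishing at infinity. A directed graph $E=(V,E^1,r,s)$ with vertex set $V$ consists of a countable set $E^1$ of edges and arbitrary range and source maps $r,s\colon E^1\to V$. A $C^*$-correspondence over a $C^*$-algebra $A$ is a right Hilbert $A$-module $X$ (with $A$-valued inner product $\langle\cdot,\cdot\rangle$, conjugate-linear in the first variable) together with a left action of $A$ given by a $*$-homomorphism from $A$ into the adjointable operators on $X$. It is nondegenerate if $\{a\cdot\xi \mid a\in A,\ \xi\in X\}$ has dense linear span in $X$. If $X,Y$ are $C^*$-correspondences over $A$, a morphism from $X$ to $Y$ is a linear map $\psi\colon X\to Y$ with $\psi(a\cdot\xi\cdot b)=a\cdot\psi(\xi)\cdot b$ and $\langle\psi(\xi),\psi(\eta)\rangle=\langle\xi,\eta\rangle$ for all $a,b\in A$ and $\xi,\eta\in X$; such maps are isometric. $\mathcal G(V)$ is the category whose objects are directed graphs with vertex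 set $V$ and whose morphisms are the injective graph morphisms which are the identity on vertices: a morphism $\phi\colon E\to F$ is an injective map $\phi\colon E^1\to F^1$ with $r_F(\phi(e))=r_E(e)$ and $s_F(\phi(e))=s_E(e)$ for all $e\in E^1$. Equality $E=F$ of objects means $E^1=F^1$, $r_E=r_F$ and $s_E=s_F$. $\mathcal C_0(V)$ is the category of nondegenerate $C^*$-correspondences over $c_0(V)$ with the morphisms above. The graph correspondence $X_E$ of $E$ is the nondegenerate $C^*$-correspondence over $c_0(V)$ given by $$X_E=\Bigl\{\xi\colon E^1\to\mathbb C \ \Bigm|\ \text{the map } v\mapsto\sum_{s(e)=v}|\xi(e)|^2 \text{ is in } c_0(V)\Bigr\},$$ with $$(a\cdot\xi\cdot b)(e)=a(r(e))\,\xi(e)\,b(s(e)),\qquad \langle\xi,\eta\rangle(v)=\sum_{s(e)=v}\overline{\xi(e)}\,\eta(e)$$ for $a,b\in c_0(V)$, $\xi,\eta\in X_E$, $e\in E^1$, $v\in V$. The characteristic functions $\chi_e$ of the singletons $\{e\}$, $e\in E^1$, are linearly independent with dense span in $X_E$. The graph-correspondence functor $\Gamma\colon\mathcal G(V)\to\mathcal C_0(V)$ is given on objects by $\Gamma(E)=X_E$; for a morphism $\phi\colon E\to F$ in $\mathcal G(V)$, $\Gamma(\phi)\colon X_E\to X_F$ is the unique morphism of $C^*$-correspondences with $\Gamma(\phi)(\chi_e)=\chi_{\phi(e)}$ for all $e\in E^1$. Equality $\Gamma(E)=\Gamma(F)$ in (i) is literal equality of objects: the same underlying set of functions (a function carrying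 its domain), with the same vector space structure, module actions and inner product. *)

(* Defs.v *)
From HB Require Import structures.
From mathcomp Require Import all_boot all_order all_algebra.
From mathcomp Require Import finmap complex ring lra.
From mathcomp Require Import boolp classical_sets functions cardinality fsbigop.
From mathcomp Require Import reals ereal topology normedtype sequences esum numfun.

Set Implicit Arguments.
Unset Strict Implicit.
Unset Printing Implicit Defensive.

Import Order.TTheory GRing.Theory Num.Theory.
Import numFieldNormedType.Exports.

Local Open Scope classical_set_scope.
Local Open Scope complex_scope.
Local Open Scope ring_scope.

Record category := Category {
  obj :> Type;
  mor : obj -> obj -> Type;
  idm : forall x, mor x x;
  compm : forall x y z, mor y z -> mor x y -> mor x z;
  comp_idl : forall x y (f : mor x y), compm (idm y) f = f;
  comp_idr : forall x y (f : mor x y), compm f (idm x) = f;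
  compA : forall x y z t (h : mor z t) (g : mor y z) (f : mor x y),
    compm h (compm g f) = compm (compm h g) f }.

Arguments idm {_} _.

Definition isomorphism (K : category) (x y : K) (f : mor x y) : Prop :=
  exists g : mor y x, compm g f = idm x /\ compm f g = idm y.

Record functor (K L : category) := Functor {
  fobj :> K -> L;
  fmor : forall x y : K, mor x y -> mor (fobj x) (fobj y);
  fmor_id : forall x : K, fmor (idm x) = idm (fobj x);
  fmor_comp : forall (x y z : K) (g : mor y z) (f : mor x y),
    fmor (compm g f) = compm (fmor g) (fmor f) }.

Arguments fmor {K L} _ {x y} _.

Notation normc := Normc.normc.

Section modulus.
Context {R : realType}.
Local Notation C := R[i].
Implicit Types (x y z : C).

Lemma normc2 z : normc z ^+ 2 = complex.Re z ^+ 2 + complex.Im z ^+ 2.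
Proof. by case: z => a b /=; rewrite sqr_sqrtr// addr_ge0 ?sqr_ge0. Qed.

Lemma normc_ge0 z : 0 <= normc z.
Proof. by case: z => a b; rewrite sqrtr_ge0. Qed.

Lemma normcD x y : normc (x + y) <= normc x + normc y.
Proof. exact: (le_normcD x y). Qed.

Lemma normcM x y : normc (x * y) = normc x * normc y.
Proof. exact: Normc.normcM. Qed.

Lemma normc_opp x : normc (- x) = normc x.
Proof. exact: (normcN x). Qed.

Lemma normc_conj x : normc x^* = normc x.
Proof. by rewrite -[x^*]/(conjc x); case: x => a b /=; rewrite sqrrN. Qed.

Lemma normc0 : normc (0 : C) = 0.
Proof. exact: Normc.normc0. Qed.

Lemma normc_real (r : R) : 0 <= r -> normc r%:C = r.
Proof. by move=> r0; rewrite /= expr0n/= addr0 sqrtr_sqr ger0_norm. Qed.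

Lemma Re_le_normc z : `|complex.Re z| <= normc z.
Proof.
by rewrite -(@ler_pXn2r _ 2)// ?nnegrE ?normr_ge0 ?normc_ge0// normc2
  real_normK ?num_real// lerDl sqr_ge0.
Qed.

Lemma Im_le_normc z : `|complex.Im z| <= normc z.
Proof.
by rewrite -(@ler_pXn2r _ 2)// ?nnegrE ?normr_ge0 ?normc_ge0// normc2
  real_normK ?num_real// lerDr sqr_ge0.
Qed.

Lemma normcD2 x y : normc (x + y) ^+ 2 <= 2 * normc x ^+ 2 + 2 * normc y ^+ 2.
Proof.
have h1 : normc (x + y) ^+ 2 <= (normc x + normc y) ^+ 2.
  by rewrite ler_pXn2r ?nnegrE ?addr_ge0 ?normc_ge0// normcD.
have h2 := sqr_ge0 (normc x - normc y); nra.
Qed.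

Lemma normcMconj2 x y : normc (x^* * y) <= normc x ^+ 2 + normc y ^+ 2.
Proof.
rewrite normcM normc_conj.
have := sqr_ge0 (normc x - normc y); have := normc_ge0 x; have := normc_ge0 y.
move: (normc x) (normc y) => a b; nra.
Qed.

Lemma conjcM_normc z : z^* * z = (normc z ^+ 2)%:C.
Proof.
by rewrite normc2 -[z^*]/(conjc z); case: z => a b /=; apply/eqP; rewrite eq_complex /=;
  apply/andP; split; apply/eqP; ring.
Qed.

End modulus.

Section sums.
Context {R : realType} {T : choiceType}.
Implicit Types (D : set T).

(* The sum of an absolutely summable family over a possibly infinite [D], from
   the suprema of finite sums of positive and negative parts. The value is
   meaningless for families that are not absolutely summable. *)
Definition rsum D (f : T -> R) : R :=
  fine (\esum_(i in D) (EFin \o f)^\+%E i) -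
  fine (\esum_(i in D) (EFin \o f)^\-%E i).

Definition csum D (f : T -> R[i]) : R[i] :=
  rsum D (fun i => complex.Re (f i)) +i* rsum D (fun i => complex.Im (f i)).

End sums.

Section sum_theory.
Context {R : realType} {T : choiceType}.
Implicit Types (D : set T) (f g p q : T -> R) (u w : T -> R[i]).
Local Notation C := R[i].

Definition asum D p : \bar R := \esum_(i in D) (p i)%:E.
Definition asummable D u := (asum D (fun i => normc (u i)) < +oo)%E.

Lemma asum_ge0 D p : (forall i, 0 <= p i) -> (0 <= asum D p)%E.
Proof. by move=> p0; apply: esum_ge0 => i _; rewrite lee_fin. Qed.

Lemma asum_fin D p : (forall i, 0 <= p i) -> (asum D p < +oo)%E ->
  asum D p \is a fin_num.
Proof. by move=> p0 h; rewrite ge0_fin_numE// asum_ge0. Qed.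

Lemma le_asum D p q : (forall i, p i <= q i) -> (asum D p <= asum D q)%E.
Proof. by move=> pq; apply: le_esum => i _; rewrite lee_fin. Qed.

Lemma asumD D p q : (forall i, 0 <= p i) -> (forall i, 0 <= q i) ->
  asum D (fun i => p i + q i) = (asum D p + asum D q)%E.
Proof.
move=> p0 q0; rewrite /asum -esumD; [|by move=> i _; rewrite lee_fin..].
by apply: eq_esum => i _; rewrite EFinD.
Qed.

Lemma asumZ D p (k : R) : 0 <= k -> (forall i, 0 <= p i) ->
  asum D (fun i => k * p i) = (k%:E * asum D p)%E.
Proof.
move=> k0 p0; rewrite /asum /esum -ereal_supZl//; last first.
  apply/set0P; exists (\sum_(i \in set0) (p i)%:E)%E => /=.
  by exists set0 => //; exact: fsets_set0.
congr ereal_sup; apply/seteqP; split => x /=.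
  move=> [A DA <-]; exists (\sum_(i \in A) (p i)%:E)%E; first by exists A.
  rewrite ge0_mule_fsumr; last by move=> i; rewrite lee_fin.
  by apply: eq_fsbigr => i _; rewrite EFinM.
move=> [y [A DA <-] <-]; exists A => //.
rewrite ge0_mule_fsumr; last by move=> i; rewrite lee_fin.
by apply: eq_fsbigr => i _; rewrite EFinM.
Qed.

Lemma fin_asumD D p q : (forall i, 0 <= p i) -> (forall i, 0 <= q i) ->
  (asum D p < +oo)%E -> (asum D q < +oo)%E ->
  fine (asum D (fun i => p i + q i)) = fine (asum D p) + fine (asum D q).
Proof. by move=> p0 q0 hp hq; rewrite asumD// fineD// asum_fin. Qed.

Lemma lt_asumD D p q : (forall i, 0 <= p i) -> (forall i, 0 <= q i) ->
  (asum D p < +oo)%E -> (asum D q < +oo)%E ->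
  (asum D (fun i => p i + q i)%R < +oo)%E.
Proof. by move=> p0 q0 hp hq; rewrite asumD// lte_add_pinfty. Qed.

Lemma lt_asumZ D p (k : R) : 0 <= k -> (forall i, 0 <= p i) ->
  (asum D p < +oo)%E -> (asum D (fun i => k * p i)%R < +oo)%E.
Proof.
move=> k0 p0 h; rewrite asumZ// -(fineK (asum_fin p0 h)) -EFinM; exact: ltry.
Qed.

Lemma lt_le_asum D p q : (forall i, p i <= q i) -> (asum D q < +oo)%E ->
  (asum D p < +oo)%E.
Proof. by move=> pq; apply: le_lt_trans; exact: le_asum. Qed.

Lemma fin_le_asum D p q : (forall i, 0 <= p i) -> (forall i, p i <= q i) ->
  (asum D q < +oo)%E -> fine (asum D p) <= fine (asum D q).
Proof.
move=> p0 pq hq; apply: fine_le; last exact: le_asum.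
  by apply: asum_fin => //; exact: lt_le_asum pq hq.
by apply: asum_fin => // i; exact: le_trans (p0 i) (pq i).
Qed.

Lemma asum_term D p i : (forall i, 0 <= p i) -> D i -> ((p i)%:E <= asum D p)%E.
Proof.
move=> p0 Di; rewrite /asum.
rewrite -(@esum_set1 _ _ i (fun i => (p i)%:E)) ?lee_fin//.
apply: esum_ge; exists [set i]; last by rewrite esum_set1 ?lee_fin// fsbig_set1.
by split => // j ->.
Qed.

Lemma rsumB D p q : (forall i, 0 <= p i) -> (forall i, 0 <= q i) ->
  (asum D p < +oo)%E -> (asum D q < +oo)%E ->
  rsum D (fun i => p i - q i) = fine (asum D p) - fine (asum D q).
Proof.
move=> p0 q0 hp hq; rewrite /rsum.
have pos (h : T -> R) : summable D (EFin \o h) ->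
    \esum_(i in D) (EFin \o h)^\+%E i \is a fin_num /\
    \esum_(i in D) (EFin \o h)^\-%E i \is a fin_num.
  move=> sh; split; rewrite ge0_fin_numE.
  - move/summable_funepos : sh; rewrite /summable; apply: le_lt_trans.
    by apply: le_esum => i _; exact: lee_abs.
  - by apply: esum_ge0 => i _; rewrite funeposE le_max lexx orbT.
  - move/summable_funeneg : sh; rewrite /summable; apply: le_lt_trans.
    by apply: le_esum => i _; exact: lee_abs.
  - by apply: esum_ge0 => i _; rewrite funenegE le_max lexx orbT.
have sum (h : T -> R) : (forall i, 0 <= h i) -> (asum D h < +oo)%E -> summable D (EFin \o h).
  move=> h0; rewrite /summable; apply: le_lt_trans; apply: le_esum => i _ /=.
  by rewrite ger0_norm.
have sp := sum _ p0 hp; have sq := sum _ q0 hq.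
have := esumB sp sq; rewrite -/(asum D p) -/(asum D q).
have -> : ((EFin \o p) \- (EFin \o q))%E = EFin \o (fun i => p i - q i).
  by apply/funext => i /=; rewrite EFinB.
have [|f1 f2] := pos (fun i => p i - q i).
  rewrite (_ : _ \o _ = ((EFin \o p) \- (EFin \o q))%E); first exact: summableB.
  by apply/funext => i /=; rewrite EFinB.
move=> H; have {H} := H (fun i _ => p0 i) (fun i _ => q0 i).
by move=> /(congr1 fine); rewrite !fineB// ?asum_fin.
Qed.

Lemma eq_rsum D f g : (forall i, D i -> f i = g i) -> rsum D f = rsum D g.
Proof.
move=> fg; rewrite /rsum; congr (fine _ - fine _);
  by apply: eq_esum => i Di; rewrite ?funeposE ?funenegE /= fg.
Qed.

Lemma eq_csum D u w : (forall i, D i -> u i = w i) -> csum D u = csum D w.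
Proof.
by move=> uw; rewrite /csum; congr (_ +i* _); apply: eq_rsum => i Di;
  rewrite uw.
Qed.

Definition rsummable D f := (asum D (fun i => `|f i|)%R < +oo)%E.

Lemma rsumposneg D f : rsummable D f ->
  exists p q : T -> R, [/\ forall i, 0 <= p i, forall i, 0 <= q i,
   (asum D p < +oo)%E, (asum D q < +oo)%E & f = (fun i => p i - q i)].
Proof.
move=> hf; exists (fun i => `|f i|), (fun i => `|f i| - f i); split => //.
- by move=> i; rewrite subr_ge0 ler_norm.
- apply: (@lt_le_asum _ _ (fun i => 2 * `|f i|)); last by apply: lt_asumZ.
  by move=> i; have := ler_norm (- f i); rewrite normrN; lra.
- by apply/funext => i; rewrite subKr.
Qed.

Lemma rsumD D f g : rsummable D f -> rsummable D g ->
  rsum D (fun i => f i + g i) = rsum D f + rsum D g.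
Proof.
move=> /rsumposneg[p [q [p0 q0 hp hq ->]]].
move=> /rsumposneg[r [s [r0 s0 hr hs ->]]].
rewrite !rsumB//.
rewrite (_ : (fun _ => _) = (fun i => (p i + r i) - (q i + s i))); last first.
  by apply/funext => i; ring.
have A (a b : T -> R) : (forall i, 0 <= a i) -> (forall i, 0 <= b i) ->
    forall i, 0 <= a i + b i by move=> a0 b0 i; rewrite addr_ge0.
rewrite (rsumB (A _ _ p0 r0) (A _ _ q0 s0) (lt_asumD p0 r0 hp hr)
  (lt_asumD q0 s0 hq hs)).
rewrite (fin_asumD p0 r0 hp hr) (fin_asumD q0 s0 hq hs).
by move: (fine _) (fine _) (fine _) (fine _) => ? ? ? ?; ring.
Qed.

Lemma rsumZ D f (k : R) : rsummable D f ->
  rsum D (fun i => k * f i) = k * rsum D f.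
Proof.
move=> /rsumposneg[p [q [p0 q0 hp hq ->]]].
rewrite (rsumB p0 q0 hp hq).
have pz (h : T -> R) (l : R) : 0 <= l -> (forall i, 0 <= h i) ->
   (asum D h < +oo)%E -> fine (asum D (fun i => l * h i)) = l * fine (asum D h).
  by move=> l0 h0 hh; rewrite asumZ// fineM// asum_fin.
have A (h : T -> R) (l : R) : 0 <= l -> (forall i, 0 <= h i) ->
    forall i, 0 <= l * h i by move=> l0 h0 i; rewrite mulr_ge0.
have [k0|k0] := leP 0 k.
  rewrite (_ : (fun _ => _) = (fun i => k * p i - k * q i)); last first.
    by apply/funext => i; ring.
  rewrite (rsumB (A _ _ k0 p0) (A _ _ k0 q0) (lt_asumZ k0 p0 hp)
    (lt_asumZ k0 q0 hq)) (pz _ _ k0 p0 hp) (pz _ _ k0 q0 hq).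
  by move: (fine _) (fine _) => ? ?; ring.
have k0' : 0 <= - k by rewrite oppr_ge0 ltW.
rewrite (_ : (fun _ => _) = (fun i => (- k) * q i - (- k) * p i)); last first.
  by apply/funext => i; ring.
rewrite (rsumB (A _ _ k0' q0) (A _ _ k0' p0) (lt_asumZ k0' q0 hq)
  (lt_asumZ k0' p0 hp)) (pz _ _ k0' p0 hp) (pz _ _ k0' q0 hq).
by move: (fine _) (fine _) => ? ?; ring.
Qed.

Lemma rsum_ge0E D p : (forall i, D i -> 0 <= p i) ->
  rsum D p = fine (asum D p).
Proof.
move=> p0; rewrite /rsum [X in _ - fine X]esum1 ?subr0.
  by congr fine; apply: eq_esum => i Di; rewrite funeposE /= max_l// lee_fin p0.
by move=> i Di; rewrite funenegE /= max_r// lee_fin oppr_le0 p0.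
Qed.

Lemma le_rsum_norm D f : rsummable D f ->
  `|rsum D f| <= 2 * fine (asum D (fun i => `|f i|)).
Proof.
move=> hf; have n0 i : 0 <= `|f i| by [].
have q0 i : 0 <= `|f i| - f i by rewrite subr_ge0 ler_norm.
have hle i : `|f i| - f i <= 2 * `|f i|.
  by have := ler_norm (- f i); rewrite normrN; lra.
have hq : (asum D (fun i => `|f i| - f i)%R < +oo)%E.
  by apply: (lt_le_asum hle); exact: lt_asumZ.
rewrite (_ : rsum D f = rsum D (fun i => `|f i| - (`|f i| - f i))); last first.
  by apply: eq_rsum => i _; rewrite subKr.
rewrite rsumB//.
have := fin_le_asum q0 hle (lt_asumZ _ n0 hf).
rewrite asumZ// fineM// ?asum_fin//=.
have h1 : 0 <= fine (asum D (fun i => `|f i|)) by rewrite fine_ge0// asum_ge0.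
have h2 : 0 <= fine (asum D (fun i => `|f i| - f i)) by rewrite fine_ge0// asum_ge0.
move: h1 h2; move: (fine _) (fine _) => a b h1 h2 h3.
have {}h3 := h3 (ler0n _ _).
rewrite ler_norml; apply/andP; split; lra.
Qed.

Lemma asummable_Re D u : asummable D u -> rsummable D (fun i => complex.Re (u i)).
Proof. by apply: lt_le_asum => i; exact: Re_le_normc. Qed.

Lemma asummable_Im D u : asummable D u -> rsummable D (fun i => complex.Im (u i)).
Proof. by apply: lt_le_asum => i; exact: Im_le_normc. Qed.

Lemma csumD D u w : asummable D u -> asummable D w ->
  csum D (fun i => u i + w i) = csum D u + csum D w.
Proof.
move=> hu hw; rewrite /csum.
rewrite (eq_rsum (g := fun i => complex.Re (u i) + complex.Re (w i))); last first.
  by move=> i _; case: (u i); case: (w i).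
rewrite (eq_rsum (f := fun i => complex.Im _)
   (g := fun i => complex.Im (u i) + complex.Im (w i))); last first.
  by move=> i _; case: (u i); case: (w i).
by rewrite (rsumD (asummable_Re hu) (asummable_Re hw))
  (rsumD (asummable_Im hu) (asummable_Im hw)).
Qed.

Lemma csumZ D u (z : C) : asummable D u ->
  csum D (fun i => z * u i) = z * csum D u.
Proof.
move=> hu; case: z => a b; rewrite /csum.
have hr := asummable_Re hu; have hi := asummable_Im hu.
have hZ f (k : R) : rsummable D f -> rsummable D (fun i => k * f i).
  move=> hf; rewrite /rsummable.
  rewrite (_ : (fun i => _) = (fun i => `|k| * `|f i|)).
    by apply: lt_asumZ.
  by apply/funext => i; rewrite normrM.
rewrite (eq_rsum (g := fun i => a * complex.Re (u i) + (- b) * complex.Im (u i))); last first.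
  by move=> i _; case: (u i) => x y /=; ring.
rewrite (eq_rsum (f := fun i => complex.Im _)
   (g := fun i => a * complex.Im (u i) + b * complex.Re (u i))); last first.
  by move=> i _; case: (u i) => x y /=; ring.
rewrite (rsumD (hZ _ _ hr) (hZ _ _ hi)) (rsumD (hZ _ _ hi) (hZ _ _ hr)).
rewrite !(rsumZ _ hr) !(rsumZ _ hi).
by apply/eqP; rewrite eq_complex /=; apply/andP; split; apply/eqP; ring.
Qed.

Lemma csum_conj D u : asummable D u -> csum D (fun i => (u i)^*) = (csum D u)^*.
Proof.
move=> hu; rewrite -[RHS]/(conjc (csum D u)) /csum /=; congr (_ +i* _).
  by apply: eq_rsum => i _; case: (u i).
rewrite (eq_rsum (g := fun i => (- 1) * complex.Im (u i))); last first.
  by move=> i _; case: (u i) => x y /=; ring.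
by rewrite rsumZ ?mulN1r//; exact: asummable_Im.
Qed.

Lemma csum_real D p : (forall i, D i -> 0 <= p i) ->
  csum D (fun i => (p i)%:C) = (fine (asum D p))%:C.
Proof.
move=> p0; rewrite /csum /= rsum_ge0E//; congr (_ +i* _).
by rewrite rsum_ge0E// /asum esum1.
Qed.

Lemma normc_csum D u : asummable D u ->
  normc (csum D u) <= 4 * fine (asum D (fun i => normc (u i))).
Proof.
move=> hu.
have h1 := le_rsum_norm (asummable_Re hu).
have h2 := le_rsum_norm (asummable_Im hu).
have k1 : fine (asum D (fun i => `|complex.Re (u i)|)) <=
          fine (asum D (fun i => normc (u i))).
  by apply: fin_le_asum => // i; exact: Re_le_normc.
have k2 : fine (asum D (fun i => `|complex.Im (u i)|)) <=
          fine (asum D (fun i => normc (u i))).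
  by apply: fin_le_asum => // i; exact: Im_le_normc.
have -> : csum D u = (rsum D (fun i => complex.Re (u i)))%:C +
   'i%C * (rsum D (fun i => complex.Im (u i)))%:C.
  by apply/eqP; rewrite eq_complex /=; apply/andP; split; apply/eqP; ring.
apply: le_trans (normcD _ _) _.
have h (x : R) : normc x%:C = `|x|.
  by rewrite /= expr0n/= addr0 sqrtr_sqr.
rewrite normcM !h /= expr0n/= expr1n add0r sqrtr1 mul1r.
lra.
Qed.

End sum_theory.

Section sum_reindex.
Context {R : realType} {T T' : choiceType}.
Implicit Types (h : T -> T').

Lemma esum_inj (D : set T) (D' : set T') h (a : T' -> \bar R) :
  injective h -> (forall i, D i <-> D' (h i)) ->
  (forall j, D' j -> (forall i, h i <> j) -> a j = 0%E) ->
  \esum_(j in D') a j = \esum_(i in D) a (h i).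
Proof.
move=> hinj DD' a0.
rewrite -(@esum_image _ _ _ D h); last by move=> i j _ _; exact: hinj.
rewrite [LHS]esum_mkcond [RHS]esum_mkcond; apply: eq_esum => j _.
case: (boolP (j \in D')) => [/set_mem D'j|nD'].
  case: (boolP (j \in _)) => // nj.
  apply: a0 => // i ij; move/negP : nj; apply; apply/mem_set.
  by exists i => //; apply/DD'; rewrite ij.
case: (boolP (j \in _)) => // /set_mem[i Di ij].
by move/negP : nD'; elim; apply/mem_set; rewrite -ij; apply/DD'.
Qed.

Lemma asum_inj (D : set T) (D' : set T') h (p : T' -> R) :
  injective h -> (forall i, D i <-> D' (h i)) ->
  (forall j, D' j -> (forall i, h i <> j) -> p j = 0) ->
  asum D' p = asum D (fun i => p (h i)).
Proof. by move=> hi hD h0; apply: esum_inj => // j D'j jn; rewrite h0. Qed.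

Lemma csum_inj (D : set T) (D' : set T') h (u : T' -> R[i]) :
  injective h -> (forall i, D i <-> D' (h i)) ->
  (forall j, D' j -> (forall i, h i <> j) -> u j = 0) ->
  csum D' u = csum D (fun i => u (h i)).
Proof.
move=> hi hD h0; rewrite /csum /rsum; congr ((fine _ - fine _) +i* (fine _ - fine _)).
- rewrite (esum_inj hi hD) => [|j D'j jn].
    by apply: eq_esum => i _; rewrite !funeposE.
  by rewrite funeposE /= h0//= maxxx.
- rewrite (esum_inj hi hD) => [|j D'j jn].
    by apply: eq_esum => i _; rewrite !funenegE.
  by rewrite funenegE /= h0//= oppr0 maxxx.
- rewrite (esum_inj hi hD) => [|j D'j jn].
    by apply: eq_esum => i _; rewrite !funeposE.
  by rewrite funeposE /= h0//= maxxx.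
- rewrite (esum_inj hi hD) => [|j D'j jn].
    by apply: eq_esum => i _; rewrite !funenegE.
  by rewrite funenegE /= h0//= oppr0 maxxx.
Qed.

End sum_reindex.

Arguments Normc.normc : simpl never.

Section c0.
Context {R : realType} {V : countType}.
Local Notation C := R[i].
Implicit Types (a b : V -> C).

Definition vanishes_at_infinity a : Prop :=
  forall e : R, 0 < e -> finite_set [set v | e <= normc (a v)].

Definition c0_pred : {pred V -> C} := fun a => `[< vanishes_at_infinity a >].

Lemma vanishes_le a b (k : R) : 0 < k ->
  (forall v, normc (b v) <= k * normc (a v)) ->
  vanishes_at_infinity a -> vanishes_at_infinity b.
Proof.
move=> k0 ab va e e0; apply: sub_finite_set (va (e / k) _) => [v /= ev|].
  by rewrite ler_pdivrMr// mulrC; exact: le_trans ev (ab v).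
by rewrite divr_gt0.
Qed.

Lemma vanishesD a b : vanishes_at_infinity a -> vanishes_at_infinity b ->
  vanishes_at_infinity (fun v => a v + b v).
Proof.
move=> va vb e e0; have e2 : 0 < e / 2 by rewrite divr_gt0.
apply: (@sub_finite_set _ _ ([set v | e / 2 <= normc (a v)] `|`
                             [set v | e / 2 <= normc (b v)])).
  move=> v /= ev; have := le_trans ev (normcD _ _).
  have [|na] := leP (e / 2) (normc (a v)); first by left.
  have [|nb] := leP (e / 2) (normc (b v)); first by right.
  move=> h; exfalso; lra.
by rewrite finite_setU; split; [exact: va|exact: vb].
Qed.

Lemma vanishes0 : vanishes_at_infinity (fun _ => 0).
Proof.
move=> e e0; apply: (@sub_finite_set _ _ set0) => // v /=.
by rewrite normc0 leNgt e0.
Qed.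

Lemma vanishes_finite a : finite_set [set v | a v <> 0] ->
  vanishes_at_infinity a.
Proof.
move=> fa e e0; apply: sub_finite_set fa => v /= ev av0.
by move: ev; rewrite av0 normc0 leNgt e0.
Qed.

Lemma vanishes_bounded a : vanishes_at_infinity a ->
  exists2 M : R, 0 < M & forall v, normc (a v) <= M.
Proof.
move=> /(_ 1 ltr01)/finite_seqP[s sE].
have s0 : 0 <= \sum_(v <- s) normc (a v).
  by apply: sumr_ge0 => v _; exact: normc_ge0.
exists (1 + \sum_(v <- s) normc (a v)); first by lra.
move=> v; have [av|/ltW av] := leP 1 (normc (a v)); last by lra.
have vs : v \in s.
  by have : [set v | 1 <= normc (a v)] v by []; rewrite sE.
 rewrite (big_rem v)//= addrCA lerDl addr_ge0//.
by apply: sumr_ge0 => w _; exact: normc_ge0.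
Qed.

Fact c0_submod : submod_closed c0_pred.
Proof.
split; first by apply/asboolP; exact: vanishes0.
move=> k a b /asboolP va /asboolP vb; apply/asboolP; apply: (vanishesD _ vb).
apply: (@vanishes_le a _ (normc k + 1)) => //.
  by rewrite ltr_wpDl// normc_ge0.
move=> v; rewrite -[(k *: a) v]/(k * a v) normcM ler_wpM2r ?normc_ge0//.
by rewrite lerDl.
Qed.

HB.instance Definition _ := GRing.isSubmodClosed.Build C (V -> C) c0_pred c0_submod.

End c0.

Record c0 (R : realType) (V : countType) := C0Fun {
  c0fun :> V -> R[i];
  c0funP : c0fun \in c0_pred }.

HB.instance Definition _ (R : realType) (V : countType) :=
  [isSub for @c0fun R V].
HB.instance Definition _ (R : realType) (V : countType) :=
  [Choice of c0 R V by <:].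
HB.instance Definition _ (R : realType) (V : countType) :=
  [SubChoice_isSubLmodule of c0 R V by <:].

Section c0_algebra.
Context {R : realType} {V : countType}.
Local Notation C := R[i].
Implicit Types (a b : c0 R V) (f : V -> C).

Lemma c0P a : vanishes_at_infinity a.
Proof. by case: a => f /= /asboolP. Qed.

Definition mkc0 f (vf : vanishes_at_infinity f) : c0 R V :=
  C0Fun (asboolT vf : f \in c0_pred).

Lemma c0_ext a b : (forall v, a v = b v) -> a = b.
Proof. by move=> ab; apply/val_inj/funext. Qed.

Fact c0_mul_vanishes a b : vanishes_at_infinity (fun v => a v * b v).
Proof.
have [M M0 aM] := vanishes_bounded (c0P a).
apply: (vanishes_le M0 _ (c0P b)) => v.
by rewrite normcM ler_wpM2r ?normc_ge0.
Qed.

Definition c0_mul a b : c0 R V := mkc0 (c0_mul_vanishes a b).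

Fact c0_conj_vanishes a : vanishes_at_infinity (fun v => (a v)^*).
Proof. by apply: (vanishes_le ltr01 _ (c0P a)) => v; rewrite normc_conj mul1r. Qed.

Definition c0_conj a : c0 R V := mkc0 (c0_conj_vanishes a).

Definition c0_norm a : R := sup [set normc (a v) | v in [set: V]].

Lemma le_c0_norm a v : normc (a v) <= c0_norm a.
Proof.
have [M M0 aM] := vanishes_bounded (c0P a).
apply: ub_le_sup; last by exists v.
by exists M => _ [w _ <-].
Qed.

Lemma c0_norm_le a (k : R) : 0 <= k -> (forall v, normc (a v) <= k) ->
  c0_norm a <= k.
Proof.
move=> k0 ak; rewrite /c0_norm.
have [->|/set0P n0] := eqVneq [set normc (a v) | v in [set: V]] set0.
  by rewrite sup0.
by apply: ge_sup => // _ [v _ <-].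
Qed.

End c0_algebra.

(* The underlying set is a subset of an ambient type [W], and the structure
   maps are defined on that subset only: [X = Y] then says that the underlying
   sets and the structures coincide. With a carrier in [Type] it would not, an
   equality of function types giving no equality of their domains. *)
Record corr_data (R : realType) (V : countType) (W : Type) := CorrData {
  carrier :> set W;
  czero : carrier;
  cadd : carrier -> carrier -> carrier;
  copp : carrier -> carrier;
  cscale : R[i] -> carrier -> carrier;
  lact : c0 R V -> carrier -> carrier;
  ract : carrier -> c0 R V -> carrier;
  inner : carrier -> carrier -> c0 R V }.

Arguments czero {R V W} _.

Section correspondence.
Context {R : realType} {V : countType} {W : Type}.
Variable X : corr_data R V W.
Implicit Types (x y z : X) (a b : c0 R V) (k l : R[i]).

Definition csub x y : X := cadd x (copp y).

Definition cnorm x : R := Num.sqrt (c0_norm (inner x x)).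

Record is_vector_space : Prop := IsVectorSpace {
  caddA : forall x y z, cadd x (cadd y z) = cadd (cadd x y) z;
  caddC : forall x y, cadd x y = cadd y x;
  cadd0 : forall x, cadd (czero X) x = x;
  caddN : forall x, cadd (copp x) x = czero X;
  cscaleA : forall k l x, cscale k (cscale l x) = cscale (k * l) x;
  cscale1 : forall x, cscale 1 x = x;
  cscaleDr : forall k x y, cscale k (cadd x y) = cadd (cscale k x) (cscale k y);
  cscaleDl : forall k l x, cscale (k + l) x = cadd (cscale k x) (cscale l x) }.

Record is_right_module : Prop := IsRightModule {
  ractA : forall x a b, ract (ract x a) b = ract x (c0_mul a b);
  ractDl : forall x y a, ract (cadd x y) a = cadd (ract x a) (ract y a);
  ractDr : forall x a b, ract x (a + b) = cadd (ract x a) (ract x b);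
  ractZl : forall k x a, ract (cscale k x) a = cscale k (ract x a);
  ractZr : forall k x a, ract x (k *: a) = cscale k (ract x a) }.

Record is_inner_product : Prop := IsInnerProduct {
  innerDr : forall x y z, inner x (cadd y z) = inner x y + inner x z;
  innerZr : forall k x y, inner x (cscale k y) = k *: inner x y;
  inner_ract : forall x y a, inner x (ract y a) = c0_mul (inner x y) a;
  inner_conj : forall x y, inner y x = c0_conj (inner x y);
  inner_ge0 : forall x v, 0 <= inner x x v;
  inner_eq0 : forall x, inner x x = 0 -> x = czero X }.

Definition is_complete : Prop := forall u : nat -> X,
  (forall e : R, 0 < e -> exists N, forall m n, (N <= m)%N -> (N <= n)%N ->
     cnorm (csub (u m) (u n)) < e) ->
  exists x, forall e : R, 0 < e -> exists N, forall n, (N <= n)%N ->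
     cnorm (csub (u n) x) < e.

Record is_hilbert_module : Prop := IsHilbertModule {
  hilbert_vector_space : is_vector_space;
  hilbert_right_module : is_right_module;
  hilbert_inner_product : is_inner_product;
  hilbert_complete : is_complete }.

Definition is_adjoint (T S : X -> X) : Prop :=
  forall x y, inner (T x) y = inner x (S y).

Record is_left_action : Prop := IsLeftAction {
  lactDr : forall a x y, lact a (cadd x y) = cadd (lact a x) (lact a y);
  lactZr : forall a k x, lact a (cscale k x) = cscale k (lact a x);
  lact_adjoint : forall a, is_adjoint (lact a) (lact (c0_conj a));
  lactDl : forall a b x, lact (a + b) x = cadd (lact a x) (lact b x);
  lactZl : forall k a x, lact (k *: a) x = cscale k (lact a x);
  lactM : forall a b x, lact (c0_mul a b) x = lact a (lact b x) }.

Definition nondegenerate : Prop := forall x (e : R), 0 < e ->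
  exists n (k : 'I_n -> R[i]) (a : 'I_n -> c0 R V) (y : 'I_n -> X),
    cnorm (csub x (\big[@cadd _ _ _ X/czero X]_(i < n)
                     cscale (k i) (lact (a i) (y i)))) < e.

End correspondence.

Record correspondence (R : realType) (V : countType) (W : Type) :=
  Correspondence {
    corr :> corr_data R V W;
    corr_hilbert : is_hilbert_module corr;
    corr_lact : is_left_action corr;
    corr_nondegenerate : nondegenerate corr }.

Record corr_mor (R : realType) (V : countType) (W : Type)
    (X Y : correspondence R V W) := CorrMor {
  cmor :> X -> Y;
  cmorD : forall x y : X, cmor (cadd x y) = cadd (cmor x) (cmor y);
  cmorZ : forall k (x : X), cmor (cscale k x) = cscale k (cmor x);
  cmor_act : forall a b (x : X),
    cmor (lact a (ract x b)) = lact a (ract (cmor x) b);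
  cmor_inner : forall x y : X, inner (cmor x) (cmor y) = inner x y }.

Section corr_category.
Context {R : realType} {V : countType} {W : Type}.
Implicit Types (X Y Z T : correspondence R V W).

Lemma corr_mor_ext X Y (f g : corr_mor X Y) : (forall x, f x = g x) -> f = g.
Proof.
case: f g => [f fD fZ fa fi] [g gD gZ ga gi] /= fg.
have {}fg : f = g by apply/funext.
by case: _ / fg in gD gZ ga gi *; congr CorrMor; exact: Prop_irrelevance.
Qed.

Definition corr_id X : corr_mor X X.
Proof. by apply: (@CorrMor _ _ _ X X id). Defined.

Definition corr_comp X Y Z (g : corr_mor Y Z) (f : corr_mor X Y) : corr_mor X Z.
Proof.
apply: (@CorrMor _ _ _ X Z (g \o f)) => [x y|k x|a b x|x y] /=.
- by rewrite !cmorD.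
- by rewrite !cmorZ.
- by rewrite !cmor_act.
- by rewrite !cmor_inner.
Defined.

Lemma corr_comp_idl X Y (f : corr_mor X Y) : corr_comp (corr_id Y) f = f.
Proof. exact: corr_mor_ext. Qed.

Lemma corr_comp_idr X Y (f : corr_mor X Y) : corr_comp f (corr_id X) = f.
Proof. exact: corr_mor_ext. Qed.

Lemma corr_compA X Y Z T (h : corr_mor Z T) (g : corr_mor Y Z)
  (f : corr_mor X Y) : corr_comp h (corr_comp g f) = corr_comp (corr_comp h g) f.
Proof. exact: corr_mor_ext. Qed.

End corr_category.

Definition corr_category (R : realType) (V : countType) (W : Type) : category :=
  Category (@corr_comp_idl R V W) (@corr_comp_idr R V W) (@corr_compA R V W).

(* Edge sets are subsets of an arbitrary ambient type [U], for [E = F] to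
   compare them as sets. *)
Record digraph (V : countType) (U : choiceType) := Digraph {
  edges :> set U;
  rng : edges -> V;
  src : edges -> V;
  edges_countable : countable edges }.

Record graph_mor (V : countType) (U : choiceType) (E F : digraph V U) :=
  GraphMor {
    gmor :> E -> F;
    gmor_inj : injective gmor;
    gmor_rng : forall e : E, rng (gmor e) = rng e;
    gmor_src : forall e : E, src (gmor e) = src e }.

Section graph_category.
Context {V : countType} {U : choiceType}.
Implicit Types (E F G H : digraph V U).

Lemma graph_mor_ext E F (f g : graph_mor E F) : (forall e, f e = g e) -> f = g.
Proof.
case: f g => [f fi fr fs] [g gi gr gs] /= fg.
have {}fg : f = g by apply/funext.
by case: _ / fg in gi gr gs *; congr GraphMor; exact: Prop_irrelevance.
Qed.

Definition graph_id E : graph_mor E E.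
Proof. by apply: (@GraphMor _ _ E E id) => //; exact: inj_id. Defined.

Definition graph_comp E F G (g : graph_mor F G) (f : graph_mor E F) :
  graph_mor E G.
Proof.
apply: (@GraphMor _ _ E G (g \o f)) => [|e|e] /=.
- exact: inj_comp (@gmor_inj _ _ _ _ g) (@gmor_inj _ _ _ _ f).
- by rewrite !gmor_rng.
- by rewrite !gmor_src.
Defined.

Lemma graph_comp_idl E F (f : graph_mor E F) : graph_comp (graph_id F) f = f.
Proof. exact: graph_mor_ext. Qed.

Lemma graph_comp_idr E F (f : graph_mor E F) : graph_comp f (graph_id E) = f.
Proof. exact: graph_mor_ext. Qed.

Lemma graph_compA E F G H (h : graph_mor G H) (g : graph_mor F G)
  (f : graph_mor E F) :
  graph_comp h (graph_comp g f) = graph_comp (graph_comp h g) f.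
Proof. exact: graph_mor_ext. Qed.

End graph_category.

Definition graph_category (V : countType) (U : choiceType) : category :=
  Category (@graph_comp_idl V U) (@graph_comp_idr V U) (@graph_compA V U).

(* Functions carry their domain: elements of X_E and X_F are both elements of
   [domfun R U], and those of X_E have domain the edge set of E. *)
Definition domfun (R : realType) (U : choiceType) := {A : set U & A -> R[i]}.

Section graph_correspondence.
Context {R : realType} {V : countType} {U : choiceType}.
Local Notation C := R[i].
Variable E : digraph V U.
Implicit Types (f g h : E -> C) (k : C) (a b : c0 R V) (v : V) (e : E).

Definition edges_from v : set E := [set e | src e = v].

Definition sqnorm f v : \bar R :=
  \esum_(e in edges_from v) (normc (f e) ^+ 2)%:E.

Definition in_graph_corr f : Prop :=
  (forall v, (sqnorm f v < +oo)%E) /\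
  vanishes_at_infinity (fun v => (fine (sqnorm f v))%:C).

Definition graph_carrier : set (domfun R U) :=
  [set w | exists2 f, in_graph_corr f & w = existT _ (edges E) f].

Definition to_carrier f (hf : in_graph_corr f) : graph_carrier :=
  SigSub (mem_set (ex_intro2 in_graph_corr (fun f => _ = existT _ (edges E) f)
            f hf (erefl (existT (fun A : set U => A -> C) (edges E) f)))).

Definition fun_of (x : graph_carrier) : E -> C :=
  s2val (cid2 (set_mem (svalP x))).

Lemma fun_ofP x : in_graph_corr (fun_of x).
Proof. by rewrite /fun_of; case: cid2. Qed.

Lemma fun_ofE x : sval x = existT _ (edges E) (fun_of x).
Proof. by rewrite /fun_of; case: cid2. Qed.

Lemma existT_domfun_inj f g :
  existT (fun A : set U => A -> C) (edges E) f = existT _ (edges E) g -> f = g.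
Proof.
by apply: Eqdep_dec.inj_pair2_eq_dec => A B; exact: pselect.
Qed.

Lemma to_carrierK f (hf : in_graph_corr f) : fun_of (to_carrier hf) = f.
Proof. by apply/esym/existT_domfun_inj; rewrite -fun_ofE. Qed.

Lemma fun_of_inj : injective fun_of.
Proof. by move=> x y xy; apply/val_inj; rewrite /= !fun_ofE xy. Qed.

Let s0 f e : 0 <= normc (f e) ^+ 2.
Proof. by rewrite exprn_ge0// normc_ge0. Qed.

Lemma sqnorm_ge0 f v : (0 <= sqnorm f v)%E.
Proof. exact: asum_ge0. Qed.

Lemma normc_sqnorm f v : normc (fine (sqnorm f v))%:C = fine (sqnorm f v).
Proof. by rewrite normc_real// fine_ge0// sqnorm_ge0. Qed.

Lemma in_graph_corr_le f g h (p q : R) : 0 < p -> 0 < q ->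
  (forall e, normc (h e) ^+ 2 <= p * normc (f e) ^+ 2 + q * normc (g e) ^+ 2) ->
  in_graph_corr f -> in_graph_corr g ->
  in_graph_corr h /\
  forall v, fine (sqnorm h v) <= p * fine (sqnorm f v) + q * fine (sqnorm g v).
Proof.
move=> p0 q0 hle [f1 f2] [g1 g2].
have pf0 e : 0 <= p * normc (f e) ^+ 2 by rewrite mulr_ge0// ltW.
have qg0 e : 0 <= q * normc (g e) ^+ 2 by rewrite mulr_ge0// ltW.
have pf v := lt_asumZ (ltW p0) (s0 f) (f1 v).
have qg v := lt_asumZ (ltW q0) (s0 g) (g1 v).
have hfin v : (sqnorm h v < +oo)%E.
  exact: (lt_le_asum hle (lt_asumD pf0 qg0 (pf v) (qg v))).
have hb v : fine (sqnorm h v) <= p * fine (sqnorm f v) + q * fine (sqnorm g v).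
  apply: le_trans (fin_le_asum (s0 h) hle (lt_asumD pf0 qg0 (pf v) (qg v))) _.
  rewrite (fin_asumD pf0 qg0 (pf v) (qg v)).
  rewrite (asumZ _ (ltW p0) (s0 f)) (asumZ _ (ltW q0) (s0 g)).
  by rewrite !fineM//; apply: asum_fin => //; [exact: g1|exact: f1].
split => //; split => //.
have pq : 0 < p + q by rewrite addr_gt0.
apply: (vanishes_le pq _ (vanishesD f2 g2)) => v /=.
have fv : 0 <= fine (sqnorm f v) by rewrite fine_ge0// sqnorm_ge0.
have gv : 0 <= fine (sqnorm g v) by rewrite fine_ge0// sqnorm_ge0.
rewrite -rmorphD normc_sqnorm normc_real ?addr_ge0//.
apply: le_trans (hb v) _.
by rewrite mulrDr !mulrDl lerD// ?lerDl ?lerDr ?mulr_ge0// ltW.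
Qed.

Lemma in_graph_corr0 : in_graph_corr (fun _ => 0).
Proof.
have s00 v : sqnorm (fun _ => 0) v = 0%E.
  by rewrite /sqnorm esum1// => e _; rewrite normc0 expr0n.
split => [v|]; first by rewrite s00 ltry.
rewrite (_ : (fun v => _) = (fun _ => 0)); first exact: vanishes0.
by apply/funext => v; rewrite s00.
Qed.

Lemma in_graph_corr_scaled f h (p : R) : 0 < p ->
  (forall e, normc (h e) <= p * normc (f e)) ->
  in_graph_corr f -> in_graph_corr h.
Proof.
move=> p0 hle hf.
have p20 : 0 < p ^+ 2 by rewrite exprn_gt0.
apply: (proj1 (in_graph_corr_le p20 ltr01 _ hf in_graph_corr0)) => e.
rewrite normc0 expr0n/= mulr0 addr0 -exprMn.
by rewrite ler_pXn2r ?nnegrE ?mulr_ge0 ?normc_ge0// ltW.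
Qed.

Lemma in_graph_corrD f g : in_graph_corr f -> in_graph_corr g ->
  in_graph_corr (fun e => f e + g e).
Proof.
move=> hf hg; apply: (proj1 (in_graph_corr_le _ _ _ hf hg)); last first.
- by move=> e; exact: normcD2.
- exact: ltr0n.
- exact: ltr0n.
Qed.

Lemma in_graph_corrN f : in_graph_corr f -> in_graph_corr (fun e => - f e).
Proof.
by apply: (in_graph_corr_scaled ltr01) => e; rewrite normc_opp mul1r.
Qed.

Lemma in_graph_corrZ k f : in_graph_corr f -> in_graph_corr (fun e => k * f e).
Proof.
apply: (@in_graph_corr_scaled _ _ (normc k + 1)).
  by rewrite ltr_wpDl// normc_ge0.
by move=> e; rewrite normcM ler_wpM2r ?normc_ge0// lerDl.
Qed.

Lemma in_graph_corr_lact a f : in_graph_corr f ->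
  in_graph_corr (fun e => a (rng e) * f e).
Proof.
have [M M0 aM] := vanishes_bounded (c0P a).
by apply: (in_graph_corr_scaled M0) => e; rewrite normcM ler_wpM2r ?normc_ge0.
Qed.

Lemma in_graph_corr_ract f a : in_graph_corr f ->
  in_graph_corr (fun e => f e * a (src e)).
Proof.
have [M M0 aM] := vanishes_bounded (c0P a).
apply: (in_graph_corr_scaled M0) => e.
by rewrite normcM mulrC ler_wpM2r ?normc_ge0.
Qed.

Definition edge_inner f g v : C :=
  csum (edges_from v) (fun e => (f e)^* * g e).

Lemma edge_asummable f g v : (sqnorm f v < +oo)%E -> (sqnorm g v < +oo)%E ->
  asummable (edges_from v) (fun e => (f e)^* * g e).
Proof.
move=> hf hg; apply: (lt_le_asum _ (lt_asumD (s0 f) (s0 g) hf hg)) => e.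
exact: normcMconj2.
Qed.

Lemma edge_inner_vanishes f g : in_graph_corr f -> in_graph_corr g ->
  vanishes_at_infinity (edge_inner f g).
Proof.
move=> [f1 f2] [g1 g2].
have four0 : 0 < 4 :> R by exact: ltr0n.
apply: (vanishes_le four0 _ (vanishesD f2 g2)) => v.
apply: le_trans (normc_csum (edge_asummable (f1 v) (g1 v))) _.
rewrite -rmorphD normc_real ?addr_ge0 ?fine_ge0 ?sqnorm_ge0//.
rewrite ler_pM2l// -(fin_asumD (s0 f) (s0 g) (f1 v) (g1 v)).
apply: fin_le_asum (lt_asumD (s0 f) (s0 g) (f1 v) (g1 v)) => e.
  exact: normc_ge0.
exact: normcMconj2.
Qed.

Definition graph_data : corr_data R V (domfun R U) := {|
  carrier := graph_carrier;
  czero := to_carrier in_graph_corr0;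
  cadd x y := to_carrier (in_graph_corrD (fun_ofP x) (fun_ofP y));
  copp x := to_carrier (in_graph_corrN (fun_ofP x));
  cscale k x := to_carrier (in_graph_corrZ k (fun_ofP x));
  lact a x := to_carrier (in_graph_corr_lact a (fun_ofP x));
  ract x b := to_carrier (in_graph_corr_ract b (fun_ofP x));
  inner x y := mkc0 (edge_inner_vanishes (fun_ofP x) (fun_ofP y)) |}.

Implicit Types (x y z : graph_data).

Lemma fun_of0 : fun_of (czero graph_data) = fun _ => 0.
Proof. exact: to_carrierK. Qed.

Lemma fun_ofD x y : fun_of (cadd x y) = fun e => fun_of x e + fun_of y e.
Proof. exact: to_carrierK. Qed.

Lemma fun_ofN x : fun_of (copp x) = fun e => - fun_of x e.
Proof. exact: to_carrierK. Qed.

Lemma fun_ofB x y : fun_of (csub x y) = fun e => fun_of x e - fun_of y e.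
Proof. by rewrite fun_ofD fun_ofN. Qed.

Lemma fun_ofZ k x : fun_of (cscale k x) = fun e => k * fun_of x e.
Proof. exact: to_carrierK. Qed.

Lemma fun_of_lact a x : fun_of (lact a x) = fun e => a (rng e) * fun_of x e.
Proof. exact: to_carrierK. Qed.

Lemma fun_of_ract x b : fun_of (ract x b) = fun e => fun_of x e * b (src e).
Proof. exact: to_carrierK. Qed.

Lemma innerE x y v : inner x y v = edge_inner (fun_of x) (fun_of y) v.
Proof. by []. Qed.

Lemma fun_of_ext x y : (forall e, fun_of x e = fun_of y e) -> x = y.
Proof. by move=> xy; apply/fun_of_inj/funext. Qed.

Lemma inner_diag x v : inner x x v = (fine (sqnorm (fun_of x) v))%:C.
Proof.
rewrite innerE /edge_inner -csum_real//.
by apply: eq_csum => e _; rewrite conjcM_normc.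
Qed.

Lemma fun_of_fin x v : (sqnorm (fun_of x) v < +oo)%E.
Proof. by case: (fun_ofP x). Qed.

Lemma fun_of_asummable x y v :
  asummable (edges_from v) (fun e => (fun_of x e)^* * fun_of y e).
Proof. by apply: edge_asummable; exact: fun_of_fin. Qed.

Lemma sqnorm_lt x v (d : R) : 0 < d -> cnorm x < d ->
  fine (sqnorm (fun_of x) v) < d ^+ 2.
Proof.
move=> d0; rewrite /cnorm => hd.
have h := le_c0_norm (inner x x) v.
rewrite inner_diag normc_sqnorm in h.
have h0 : 0 <= c0_norm (inner x x).
  by apply: le_trans h; rewrite fine_ge0// sqnorm_ge0.
apply: le_lt_trans h _; rewrite -(sqr_sqrtr h0).
by rewrite ltr_pXn2r ?nnegrE ?sqrtr_ge0// ltW.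
Qed.

Lemma cnorm_le x (d : R) : 0 <= d ->
  (forall v, fine (sqnorm (fun_of x) v) <= d ^+ 2) -> cnorm x <= d.
Proof.
move=> d0 hd; rewrite /cnorm -[leRHS](ger0_norm d0) -sqrtr_sqr ler_wsqrtr//.
apply: c0_norm_le; first exact: sqr_ge0.
by move=> v; rewrite inner_diag normc_sqnorm.
Qed.

Lemma graph_vector_space : is_vector_space graph_data.
Proof.
split.
- by move=> x y z; apply: fun_of_ext => e; rewrite !fun_ofD addrA.
- by move=> x y; apply: fun_of_ext => e; rewrite !fun_ofD addrC.
- by move=> x; apply: fun_of_ext => e; rewrite !fun_ofD fun_of0 add0r.
- by move=> x; apply: fun_of_ext => e; rewrite !fun_ofD fun_ofN fun_of0 addNr.
- by move=> k l x; apply: fun_of_ext => e; rewrite !fun_ofZ mulrA.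
- by move=> x; apply: fun_of_ext => e; rewrite !fun_ofZ mul1r.
- by move=> k x y; apply: fun_of_ext => e; rewrite !(fun_ofZ,fun_ofD) mulrDr.
- by move=> k l x; apply: fun_of_ext => e; rewrite !(fun_ofZ,fun_ofD) mulrDl.
Qed.

Lemma graph_right_module : is_right_module graph_data.
Proof.
split.
- by move=> x a b; apply: fun_of_ext => e; rewrite !fun_of_ract mulrA.
- move=> x y a; apply: fun_of_ext => e.
  by rewrite !(fun_of_ract, fun_ofD) mulrDl.
- move=> x a b; apply: fun_of_ext => e.
  by rewrite !(fun_of_ract, fun_ofD) mulrDr.
- move=> k x a; apply: fun_of_ext => e.
  by rewrite !(fun_of_ract, fun_ofZ) mulrA.
- move=> k x a; apply: fun_of_ext => e.
  by rewrite !(fun_of_ract, fun_ofZ) mulrCA.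
Qed.

Lemma graph_inner_product : is_inner_product graph_data.
Proof.
split.
- move=> x y z; apply: c0_ext => v; rewrite innerE /edge_inner fun_ofD.
  rewrite -[RHS]/(inner x y v + inner x z v) !innerE.
  rewrite -(csumD (fun_of_asummable x y v) (fun_of_asummable x z v)).
  by apply: eq_csum => e _; rewrite mulrDr.
- move=> k x y; apply: c0_ext => v; rewrite innerE /edge_inner fun_ofZ.
  rewrite -[RHS]/(k * inner x y v) !innerE.
  rewrite -(csumZ _ (fun_of_asummable x y v)).
  by apply: eq_csum => e _; rewrite mulrCA.
- move=> x y a; apply: c0_ext => v; rewrite innerE /edge_inner fun_of_ract.
  rewrite -[RHS]/(inner x y v * a v) !innerE mulrC.
  rewrite -(csumZ _ (fun_of_asummable x y v)).
  by apply: eq_csum => e <-; rewrite mulrA mulrC.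
- move=> x y; apply: c0_ext => v; rewrite -[RHS]/((inner x y v)^*) !innerE.
  rewrite -(csum_conj (fun_of_asummable x y v)).
  by apply: eq_csum => e _; rewrite rmorphM /= conjCK mulrC.
- by move=> x v; rewrite inner_diag ler0c fine_ge0// sqnorm_ge0.
- move=> x x0; apply: fun_of_ext => e; rewrite fun_of0.
  have := inner_diag x (src e); rewrite x0 => /esym /complexI h.
  have fe : ((normc (fun_of x e) ^+ 2)%:E <= sqnorm (fun_of x) (src e))%E.
    exact: (asum_term (s0 (fun_of x))).
  have sE : sqnorm (fun_of x) (src e) = (fine (sqnorm (fun_of x) (src e)))%:E.
    exact: esym (fineK (asum_fin (s0 _) (fun_of_fin x (src e)))).
  move: fe; rewrite sE h lee_fin => fe.
  apply: Normc.eq0_normc; apply/eqP; rewrite -sqrf_eq0 eq_le fe.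
  exact: s0.
Qed.

Lemma graph_left_action : is_left_action graph_data.
Proof.
split.
- move=> a x y; apply: fun_of_ext => e.
  by rewrite !(fun_of_lact, fun_ofD) mulrDr.
- move=> a k x; apply: fun_of_ext => e.
  by rewrite !(fun_of_lact, fun_ofZ) mulrCA.
- move=> a x y; apply: c0_ext => v; rewrite !innerE /edge_inner !fun_of_lact.
  by apply: eq_csum => e _; rewrite rmorphM /= mulrA (mulrC (_^*)).
- move=> a b x; apply: fun_of_ext => e.
  by rewrite !(fun_of_lact, fun_ofD) mulrDl.
- move=> k a x; apply: fun_of_ext => e.
  by rewrite !(fun_of_lact, fun_ofZ) mulrA.
- by move=> a b x; apply: fun_of_ext => e; rewrite !fun_of_lact mulrA.
Qed.

End graph_correspondence.

Section sum_extra.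
Context {R : realType} {T : choiceType}.
Implicit Types (D : set T) (p q : T -> R) (u : T -> R[i]).

Lemma asum_eq_term D p q : (forall i, 0 <= p i) -> (forall i, p i <= q i) ->
  (asum D q < +oo)%E -> fine (asum D p) = fine (asum D q) ->
  forall i, D i -> p i = q i.
Proof.
move=> p0 pq hq pqE i Di.
have d0 j : 0 <= q j - p j by rewrite subr_ge0.
have dq j : q j - p j <= q j by rewrite gerBl.
have hp : (asum D p < +oo)%E := lt_le_asum pq hq.
have hd : (asum D (fun j => q j - p j)%R < +oo)%E := lt_le_asum dq hq.
have := fin_asumD p0 d0 hp hd.
rewrite (_ : (fun _ => _) = q); last by apply/funext => j; rewrite addrC subrK.
rewrite -pqE => /esym/eqP; rewrite -subr_eq0 addrAC subrr add0r => /eqP dE.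
have := asum_term d0 Di; rewrite -(fineK (asum_fin d0 hd)) dE lee_fin => h.
by apply/eqP; rewrite eq_sym -subr_eq0 eq_le h d0.
Qed.

Lemma fsum_le_asum D p (A : set T) : finite_set A -> A `<=` D ->
  (forall i, 0 <= p i) -> (asum D p < +oo)%E ->
  \sum_(i <- fset_set A) p i <= fine (asum D p).
Proof.
move=> fA AD p0 hp; rewrite -lee_fin (fineK (asum_fin p0 hp)).
apply: esum_ge; exists A => //.
by rewrite fsbig_finite//= sumEFin.
Qed.

Lemma asum_le_fsum D p (k : R) :
  (forall A, finite_set A -> A `<=` D -> \sum_(i <- fset_set A) p i <= k) ->
  (asum D p <= k%:E)%E.
Proof.
move=> h; apply: ge_ereal_sup => _ [A [fA AD] <-].
by rewrite fsbig_finite//= sumEFin lee_fin h.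
Qed.

Lemma asum_fsum_lt D p (d : R) : (forall i, 0 <= p i) -> (asum D p < +oo)%E ->
  0 < d -> exists A, [/\ finite_set A, A `<=` D &
    fine (asum D p) - d < \sum_(i <- fset_set A) p i].
Proof.
move=> p0 hp d0; have hf := asum_fin p0 hp.
have [_ [A [fA AD] <-]] := ub_ereal_sup_adherent d0 hf.
rewrite -/(esum D (fun i => (p i)%:E)) -/(asum D p) => h; exists A; split => //.
move: h; rewrite -{1}(fineK hf) -EFinB fsbig_finite//= sumEFin.
by rewrite lte_fin.
Qed.

Lemma esum_single D (a : T -> \bar R) i : D i -> (forall j, (0 <= a j)%E) ->
  (forall j, j <> i -> a j = 0%E) -> \esum_(j in D) a j = a i.
Proof.
move=> Di a0 ai; rewrite (esumID [set i])//.
rewrite (_ : D `&` [set i] = [set i]); last first.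
  by apply/seteqP; split => [j []//|j ->].
by rewrite esum_set1// esum1 ?adde0// => j [_ /ai].
Qed.

Lemma csum_single D u i : D i -> (forall j, j <> i -> u j = 0) -> csum D u = u i.
Proof.
move=> Di ui; rewrite /csum.
have rs (f : T -> R) : (forall j, j <> i -> f j = 0) -> rsum D f = f i.
  move=> fi; rewrite /rsum !(@esum_single D _ i)//.
  - rewrite funeposE funenegE /=.
    have [h|h] := leP 0 (f i).
      by rewrite max_l ?lee_fin// max_r ?lee_fin ?oppr_le0// subr0.
    by rewrite max_r ?lee_fin ?ltW// max_l ?lee_fin ?oppr_ge0 ?ltW//= sub0r opprK.
  - by move=> j ji; rewrite funenegE /= fi// oppr0 maxxx.
  - by move=> j ji; rewrite funeposE /= fi// maxxx.
rewrite !rs; first by case: (u i).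
- by move=> j ji; rewrite ui.
- by move=> j ji; rewrite ui.
Qed.

End sum_extra.

Section limits.
Context {R : realType}.

Lemma real_cauchy_lim (a : nat -> R) :
  (forall d, 0 < d -> exists N, forall m n, (N <= m)%N -> (N <= n)%N ->
     `|a m - a n| < d) ->
  exists l, forall d, 0 < d -> exists N, forall n, (N <= n)%N -> `|a n - l| < d.
Proof.
move=> h.
have c : cvg (a @ \oo).
  apply: cauchy_cvg; apply: cauchy_exP => d d0.
  have [N hN] := h d d0; exists (a N); exists N => // n /= Nn.
  by rewrite /ball /= hN.
exists (lim (a @ \oo)) => d d0.
have [N _ hN] := (@cvgr_dist_lt _ _ _ _ _ _ _ c) d d0.
by exists N => n /hN /=; rewrite distrC.
Qed.

Lemma complex_cauchy_lim (z : nat -> R[i]) :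
  (forall d, 0 < d -> exists N, forall m n, (N <= m)%N -> (N <= n)%N ->
     normc (z m - z n) < d) ->
  exists l, forall d, 0 < d -> exists N, forall n, (N <= n)%N ->
     normc (z n - l) < d.
Proof.
move=> h.
have [|x hx] := @real_cauchy_lim (fun n => complex.Re (z n)).
  move=> d /h[N hN]; exists N => m n Nm Nn; apply: le_lt_trans (hN _ _ Nm Nn).
  apply: le_trans (Re_le_normc _).
  by case: (z m) (z n) => [? ?] [? ?].
have [|y hy] := @real_cauchy_lim (fun n => complex.Im (z n)).
  move=> d /h[N hN]; exists N => m n Nm Nn; apply: le_lt_trans (hN _ _ Nm Nn).
  apply: le_trans (Im_le_normc _).
  by case: (z m) (z n) => [? ?] [? ?].
exists (x +i* y) => d d0.
have d2 : 0 < d / 2 by rewrite divr_gt0.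
have [N hN] := hx _ d2; have [M hM] := hy _ d2.
exists (maxn N M) => n; rewrite geq_max => /andP[/hN hn1 /hM hn2].
rewrite -(@ltr_pXn2r _ 2)// ?nnegrE ?normc_ge0 ?ltW// normc2.
have -> : complex.Re (z n - x +i* y) = complex.Re (z n) - x by case: (z n).
have -> : complex.Im (z n - x +i* y) = complex.Im (z n) - y by case: (z n).
move: hn1 hn2; rewrite !ltr_norml => /andP[a1 a2] /andP[b1 b2]; nra.
Qed.

End limits.

Section graph_complete.
Context {R : realType} {V : countType} {U : choiceType}.
Variable E : digraph V U.
Local Notation C := R[i].
Local Notation X := (@graph_data R V U E).
Implicit Types (f g : E -> C).

Let s0 f e : 0 <= normc (f e) ^+ 2.
Proof. by rewrite exprn_ge0// normc_ge0. Qed.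

Lemma le_sqnorm f e : (sqnorm f (src e) < +oo)%E ->
  normc (f e) ^+ 2 <= fine (sqnorm f (src e)).
Proof.
move=> hf; have := asum_term (s0 f) (erefl (src e) : edges_from (src e) e).
by rewrite -(fineK (asum_fin (s0 f) hf)) lee_fin.
Qed.

Lemma fsum_lim (u : nat -> E -> C) g (s : seq E) :
  (forall e d, 0 < d -> exists N, forall n, (N <= n)%N ->
     normc (u n e - g e) < d) ->
  forall d, 0 < d -> exists N, forall n, (N <= n)%N ->
    \sum_(e <- s) normc (u n e - g e) ^+ 2 <= d.
Proof.
move=> h; elim: s => [|e s IH] d d0.
  by exists 0%N => n _; rewrite big_nil ltW.
have d2 : 0 < d / 2 by rewrite divr_gt0.
have [N hN] := IH _ d2.
have sd : 0 < Num.sqrt (d / 2) by rewrite sqrtr_gt0.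
have [M hM] := h e _ sd.
exists (maxn N M) => n; rewrite geq_max => /andP[/hN hn /hM hm].
rewrite big_cons (splitr d) lerD//.
rewrite -(sqr_sqrtr (ltW d2)) ler_pXn2r ?nnegrE ?normc_ge0 ?sqrtr_ge0//.
exact: ltW.
Qed.

Lemma graph_complete : is_complete X.
Proof.
move=> u hu; pose f n := fun_of (u n).
have fB m n : fun_of (csub (u m) (u n)) = fun e => f m e - f n e.
  exact: fun_ofB.
have hC d : 0 < d -> exists N, forall m n, (N <= m)%N -> (N <= n)%N ->
    forall v, fine (sqnorm (fun e => f m e - f n e) v) < d ^+ 2.
  move=> d0; have [N hN] := hu d d0; exists N => m n Nm Nn v.
  by rewrite -fB; apply: sqnorm_lt => //; exact: hN.
have fin m n v : (sqnorm (fun e => (f m e - f n e)%R) v < +oo)%E.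
  by rewrite -fB; exact: fun_of_fin.
have /choice[g hg] : forall e, exists l : C, forall d, 0 < d ->
    exists N, forall n, (N <= n)%N -> normc (f n e - l) < d.
  move=> e; apply: complex_cauchy_lim => d d0.
  have [N hN] := hC d d0; exists N => m n Nm Nn.
  have := hN m n Nm Nn (src e).
  move=> /(le_lt_trans (le_sqnorm (fin m n (src e)))).
  by rewrite ltr_pXn2r ?nnegrE ?normc_ge0// ltW.
have key d : 0 < d -> exists N, forall n, (N <= n)%N -> forall v,
    (sqnorm (fun e => (f n e - g e)%R) v <= (4 * d ^+ 2)%:E)%E.
  move=> d0; have [N hN] := hC d d0; exists N => n Nn v.
  apply: asum_le_fsum => A fA AD.
  have d20 : 0 < d ^+ 2 by rewrite exprn_gt0.
  have [M hM] := fsum_lim (fset_set A) hg d20.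
  have {}hM := hM (maxn N M) (leq_maxr _ _).
  have {}hN := hN n (maxn N M) Nn (leq_maxl _ _) v.
  have hA := fsum_le_asum fA AD (s0 (fun e => f n e - f (maxn N M) e)) (fin n (maxn N M) v).
  have h1 : \sum_(e <- fset_set A) normc (f n e - f (maxn N M) e) ^+ 2 <= d ^+ 2.
    exact: le_trans hA (ltW hN).
  apply: (@le_trans _ _ (\sum_(e <- fset_set A)
     (2 * normc (f n e - f (maxn N M) e) ^+ 2 +
      2 * normc (f (maxn N M) e - g e) ^+ 2))).
    apply: ler_sum => e _; apply: le_trans (normcD2 _ _).
    by rewrite addrA subrK.
  rewrite big_split/= -!mulr_sumr.
  have -> : 4 * d ^+ 2 = 2 * d ^+ 2 + 2 * d ^+ 2 by ring.
  by rewrite lerD// ler_pM2l.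
have gle n v : (sqnorm (fun e => (f n e - g e)%R) v < +oo)%E ->
    (sqnorm g v < +oo)%E /\ fine (sqnorm g v) <=
    2 * fine (sqnorm (f n) v) + 2 * fine (sqnorm (fun e => f n e - g e) v).
  move=> hd; have hf : (sqnorm (f n) v < +oo)%E := fun_of_fin (u n) v.
  have two0 : 0 <= 2 :> R by exact: ler0n.
  have a1 e : 0 <= 2 * normc (f n e) ^+ 2 by rewrite mulr_ge0.
  have a2 e : 0 <= 2 * normc (f n e - g e) ^+ 2 by rewrite mulr_ge0// exprn_ge0// normc_ge0.
  have b1 := lt_asumZ two0 (s0 (f n)) hf.
  have b2 := lt_asumZ two0 (s0 (fun e => f n e - g e)) hd.
  have le e : normc (g e) ^+ 2 <=
      2 * normc (f n e) ^+ 2 + 2 * normc (f n e - g e) ^+ 2.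
    rewrite -(normc_opp (f n e - g e)).
    by apply: le_trans (normcD2 _ _); rewrite opprB addrC subrK.
  split; first exact: lt_le_asum le (lt_asumD a1 a2 b1 b2).
  apply: le_trans (fin_le_asum (s0 g) le (lt_asumD a1 a2 b1 b2)) _.
  rewrite (fin_asumD a1 a2 b1 b2).
  rewrite (asumZ _ two0 (s0 (f n))) (asumZ _ two0 (s0 (fun e => f n e - g e))).
  by rewrite !fineM//; apply: asum_fin => //; exact: s0.
have gin : in_graph_corr g.
  split=> [v|e e0].
    have [N hN] := key 1 ltr01.
    by have [] := gle N v (le_lt_trans (hN N (leqnn _) v) (ltry _)).
  pose d := Num.min 1 (e / 16).
  have d0 : 0 < d by rewrite lt_min ltr01 divr_gt0// ltr0n.
  have dle : d ^+ 2 <= e / 16.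
    have h1 : d <= 1 by rewrite ge_min lexx.
    have h2 : d <= e / 16 by rewrite ge_min lexx orbT.
    by apply: le_trans h2; rewrite expr2 ler_piMr// ltW.
  have [N hN] := key d d0.
  have [_ fv] := fun_ofP (u N).
  have e4 : 0 < e / 4 by rewrite divr_gt0.
  apply: sub_finite_set (fv _ e4) => v /=; rewrite !normc_sqnorm => ev.
  rewrite leNgt; apply/negP => lt4.
  have hNv := hN N (leqnn _) v.
  have [_ h] := gle N v (le_lt_trans hNv (ltry _)).
  have h3 : fine (sqnorm (fun e => f N e - g e) v) <= 4 * d ^+ 2.
    rewrite -lee_fin; rewrite (fineK (asum_fin (s0 _) _))//.
    exact: le_lt_trans hNv (ltry _).
  rewrite -/(f N) in lt4.
  move: h h3 lt4 ev dle; lra.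
exists (to_carrier gin : X) => e e0.
have e4 : 0 < e / 4 by rewrite divr_gt0.
have [N hN] := key _ e4; exists N => n Nn.
apply: (@le_lt_trans _ _ (e / 2)); last by rewrite ltr_pdivrMr// ltr_pMr// ltr1n.
apply: cnorm_le => [|v]; first by rewrite ltW// divr_gt0.
have -> : fun_of (csub (u n) (to_carrier gin : X)) = fun e => f n e - g e.
  by rewrite fun_ofB to_carrierK.
have hNv := hN n Nn v.
have h3 : fine (sqnorm (fun e => f n e - g e) v) <= 4 * (e / 4) ^+ 2.
  rewrite -lee_fin; rewrite (fineK (asum_fin (s0 _) _))//.
  exact: le_lt_trans hNv (ltry _).
by apply: le_trans h3 _; rewrite le_eqVlt; apply/orP; left; apply/eqP; field.
Qed.

Lemma graph_nondegenerate : nondegenerate X.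
Proof.
move=> x e e0; pose f := fun_of x.
pose d := e / 2; have d0 : 0 < d by rewrite divr_gt0.
have d20 : 0 < d ^+ 2 by rewrite exprn_gt0.
have /choice[A hA] : forall v, exists A : set E, [/\ finite_set A, A `<=` edges_from v &
    fine (sqnorm f v) - d ^+ 2 < \sum_(i <- fset_set A) normc (f i) ^+ 2].
  by move=> v; exact: asum_fsum_lt (s0 f) (fun_of_fin x v) d20.
pose B := [set v | d ^+ 2 <= fine (sqnorm f v)].
have fB : finite_set B.
  have [_ /(_ _ d20)] := fun_ofP x; apply: sub_finite_set => v.
  by rewrite /= normc_sqnorm.
pose K := (@rng _ _ E) @` (\bigcup_(v in B) A v).
have fK : finite_set K.
  apply: finite_image; apply: bigcup_finite => // v _.
  by case: (hA v).
have aK : vanishes_at_infinity (fun v => if v \in K then 1 else 0 : C).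
  apply: vanishes_finite; apply: sub_finite_set fK => v /=.
  by case: ifPn => // /set_mem.
exists 1%N, (fun _ => 1), (fun _ => mkc0 aK), (fun _ => x).
rewrite big_ord_recl big_ord0.
apply: (@le_lt_trans _ _ d); last by rewrite ltr_pdivrMr// ltr_pMr// ltr1n.
apply: cnorm_le => [|v]; first exact: ltW.
set g := fun_of _.
have gE e' : g e' = if rng e' \in K then 0 else f e'.
  rewrite /g fun_ofB fun_ofD fun_of0 fun_ofZ fun_of_lact /= addr0 mul1r.
  by case: ifP; rewrite ?mul1r ?mul0r ?subrr ?subr0.
have gf e' : normc (g e') ^+ 2 <= normc (f e') ^+ 2.
  by rewrite gE; case: ifP => // _; rewrite normc0 expr0n.
have hf := fun_of_fin x v.
have hg := lt_le_asum gf hf.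
have [dv|/ltW dv] := leP (d ^+ 2) (fine (sqnorm f v)); last first.
  exact: le_trans (fin_le_asum (s0 g) gf hf) dv.
have [fA AD lA] := hA v.
pose p e' := if e' \in A v then normc (f e') ^+ 2 else 0.
have p0 e' : 0 <= p e' by rewrite /p; case: ifP.
have pf e' : p e' <= normc (f e') ^+ 2 by rewrite /p; case: ifP.
have hp := lt_le_asum pf hf.
have gpf e' : normc (g e') ^+ 2 + p e' <= normc (f e') ^+ 2.
  rewrite gE; case: ifPn => [_|nK]; first by rewrite normc0 expr0n/= add0r pf.
  rewrite /p.
  case: (boolP (e' \in A v)) => [/set_mem Ae'|_]; last by rewrite addr0.
  by move/negP : nK; elim; apply/mem_set; rewrite /K /=; exists e' => //; exists v.
have gp0 e' : 0 <= normc (g e') ^+ 2 + p e' by rewrite addr_ge0.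
have h1 := fin_le_asum gp0 gpf hf.
rewrite (fin_asumD (s0 g) p0 hg hp) in h1.
have h2 := fsum_le_asum fA AD p0 hp.
have h3 : \sum_(i <- fset_set (A v)) p i = \sum_(i <- fset_set (A v)) normc (f i) ^+ 2.
  rewrite big_seq [RHS]big_seq; apply: eq_bigr => i.
  by rewrite in_fset_set// /p => ->.
rewrite h3 in h2; rewrite /sqnorm -/(asum _ _) in lA *.
by move: (fine _) (fine _) (fine _) (\sum_(i <- _) _) h1 h2 lA => ? ? ? ?; lra.
Qed.

Definition graph_corr : correspondence R V (domfun R U) := {|
  corr := X;
  corr_hilbert := IsHilbertModule (@graph_vector_space R V U E)
    (@graph_right_module R V U E) (@graph_inner_product R V U E) graph_complete;
  corr_lact := @graph_left_action R V U E;
  corr_nondegenerate := graph_nondegenerate |}.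

End graph_complete.

Section chi.
Context {R : realType} {V : countType} {U : choiceType}.
Variable E : digraph V U.
Local Notation C := R[i].

Definition chi_fun (e : E) : E -> C := fun e' => (e' == e)%:R.

Lemma sqnorm_chi e v :
  sqnorm (chi_fun e) v = if src e == v then 1%E else 0%E.
Proof.
have chi2 e' : normc (chi_fun e e') ^+ 2 = (e' == e)%:R.
  by rewrite /chi_fun; case: eqP => _; rewrite ?normc0 ?Normc.normc1 ?expr0n ?expr1n.
rewrite /sqnorm; case: eqP => ev.
  rewrite (@esum_single _ _ _ _ e)//.
  - by rewrite chi2 eqxx.
  - by move=> e'; rewrite chi2 lee_fin ler0n.
  - by move=> e' /eqP/negbTE e'e; rewrite chi2 e'e.
rewrite esum1// => e' e'v; rewrite chi2; case: eqP => // e'e.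
by case: ev; rewrite -e'e.
Qed.

Lemma in_graph_corr_chi e : in_graph_corr (chi_fun e).
Proof.
split=> [v|]; first by rewrite sqnorm_chi; case: ifP => _; exact: ltry.
apply: vanishes_finite; apply: (sub_finite_set _ (finite_set1 (src e))) => v /=.
by rewrite sqnorm_chi; case: eqP.
Qed.

Definition chi (e : E) : graph_corr E := to_carrier (in_graph_corr_chi e).

Lemma fun_of_chi e : fun_of (chi e) = chi_fun e.
Proof. exact: to_carrierK. Qed.

Lemma inner_chi e (x : graph_corr E) : inner (chi e) x (src e) = fun_of x e.
Proof.
rewrite innerE /edge_inner fun_of_chi (@csum_single _ _ _ _ e)//.
  by rewrite /chi_fun conjC_nat eqxx mul1r.
by move=> e' /eqP/negbTE e'e; rewrite /chi_fun conjC_nat e'e mul0r.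
Qed.

End chi.

Section gamma.
Context {R : realType} {V : countType} {U : choiceType}.
Local Notation C := R[i].
Implicit Types E F G : digraph V U.

Section push.
Variables (E F : digraph V U) (phi : graph_mor E F).
Implicit Types (f g : E -> C).

Definition push f : F -> C := fun e' =>
  if pselect (exists e, phi e = e') is left h then f (sval (cid h)) else 0.

Lemma pushE f e : push f (phi e) = f e.
Proof.
rewrite /push; case: pselect => [h|[]]; last by exists e.
by congr f; apply: (@gmor_inj _ _ _ _ phi); case: cid.
Qed.

Lemma push0 f e' : (forall e, phi e <> e') -> push f e' = 0.
Proof. by move=> ne; rewrite /push; case: pselect => // h; have [e /ne] := h. Qed.

Lemma push_ind (P : F -> Prop) : (forall e, P (phi e)) ->
  (forall e', (forall e, phi e <> e') -> P e') -> forall e', P e'.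
Proof.
move=> Pphi Pn e'; have [[e <-//]|ne] := pselect (exists e, phi e = e').
by apply: Pn => e ee'; apply: ne; exists e.
Qed.

Lemma edges_from_mor v e : edges_from v e <-> edges_from v (phi e).
Proof. by rewrite /edges_from /= gmor_src. Qed.

Lemma sqnorm_push f v : sqnorm (push f) v = sqnorm f v.
Proof.
rewrite /sqnorm (esum_inj (@gmor_inj _ _ _ _ phi) (edges_from_mor v)).
  by apply: eq_esum => e _; rewrite pushE.
by move=> e' _ ne; rewrite push0// normc0 expr0n.
Qed.

Lemma in_graph_corr_push f : in_graph_corr f -> in_graph_corr (push f).
Proof.
move=> [f1 f2]; split => [v|]; first by rewrite sqnorm_push.
rewrite (_ : (fun v => _) = (fun v => (fine (sqnorm f v))%:C))//.
by apply/funext => v; rewrite sqnorm_push.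
Qed.

Definition push_corr (x : graph_corr E) : graph_corr F :=
  to_carrier (in_graph_corr_push (fun_ofP x)).

Lemma fun_of_push x : fun_of (push_corr x) = push (fun_of x).
Proof. exact: to_carrierK. Qed.

Definition push_mor : corr_mor (graph_corr (R := R) E) (graph_corr F).
Proof.
apply: (@CorrMor _ _ _ _ _ push_corr).
- move=> x y; apply: fun_of_ext; apply: push_ind => [e|e' ne].
    by rewrite fun_ofD !fun_of_push !pushE fun_ofD.
  by rewrite fun_ofD !fun_of_push !push0// addr0.
- move=> k x; apply: fun_of_ext; apply: push_ind => [e|e' ne].
    by rewrite fun_ofZ !fun_of_push !pushE fun_ofZ.
  by rewrite fun_ofZ !fun_of_push !push0// mulr0.
- move=> a b x; apply: fun_of_ext; apply: push_ind => [e|e' ne].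
    rewrite fun_of_lact fun_of_ract !fun_of_push !pushE fun_of_lact fun_of_ract.
    by rewrite gmor_rng gmor_src.
  by rewrite fun_of_lact fun_of_ract !fun_of_push !push0// mul0r mulr0.
- move=> x y; apply: c0_ext => v; rewrite !innerE /edge_inner !fun_of_push.
  rewrite (csum_inj (@gmor_inj _ _ _ _ phi) (edges_from_mor v)).
    by apply: eq_csum => e _; rewrite !pushE.
  by move=> e' _ ne; rewrite !push0// mulr0.
Defined.

Lemma push_chi e : push_mor (chi e) = chi (phi e).
Proof.
apply: fun_of_ext; apply: push_ind => [e'|e' ne].
  rewrite fun_of_push pushE !fun_of_chi /chi_fun.
  by rewrite (inj_eq (@gmor_inj _ _ _ _ phi)).
rewrite fun_of_push push0// fun_of_chi /chi_fun.
by case: eqP => // e'e; case: (ne e).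
Qed.

Lemma graph_corr_mor_uniq (psi : corr_mor (graph_corr (R := R) E) (graph_corr F)) :
  (forall e, psi (chi e) = chi (phi e)) -> psi = push_mor.
Proof.
move=> psichi; apply: corr_mor_ext => x; apply: fun_of_ext.
have im e : fun_of (psi x) (phi e) = fun_of x e.
  by rewrite -inner_chi -psichi cmor_inner gmor_src inner_chi.
apply: push_ind => [e|e' ne]; first by rewrite fun_of_push pushE.
rewrite fun_of_push push0//.
have s0 (f : F -> C) e : 0 <= normc (f e) ^+ 2.
  by rewrite exprn_ge0// normc_ge0.
have le e : normc (push (fun_of x) e) ^+ 2 <= normc (fun_of (psi x) e) ^+ 2.
  move: e; apply: push_ind => [e|e ne']; first by rewrite pushE im.
  by rewrite push0// normc0 expr0n s0.
have sE : fine (sqnorm (push (fun_of x)) (src e')) =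
          fine (sqnorm (fun_of (psi x)) (src e')).
  apply: complexI; rewrite sqnorm_push -!inner_diag.
  exact: esym (congr1 (fun a : c0 R V => a (src e')) (cmor_inner psi x x)).
have := asum_eq_term (s0 _) le (fun_of_fin (psi x) (src e')) sE
  (erefl : edges_from (src e') e').
rewrite push0// normc0 expr0n => /esym/eqP; rewrite sqrf_eq0 => /eqP.
exact: Normc.eq0_normc.
Qed.

Lemma graph_corr_mor_ex :
  exists! psi : corr_mor (graph_corr (R := R) E) (graph_corr F),
    forall e, psi (chi e) = chi (phi e).
Proof.
exists push_mor; split; first exact: push_chi.
by move=> psi psichi; rewrite (graph_corr_mor_uniq psichi).
Qed.

Definition graph_corr_mor : corr_mor (graph_corr (R := R) E) (graph_corr F) :=
  sval (cid graph_corr_mor_ex).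

Lemma graph_corr_mor_chi e : graph_corr_mor (chi e) = chi (phi e).
Proof. exact: (svalP (cid graph_corr_mor_ex)).1. Qed.

Lemma graph_corr_morP (psi : corr_mor (graph_corr (R := R) E) (graph_corr F)) :
  (forall e, psi (chi e) = chi (phi e)) -> graph_corr_mor = psi.
Proof. exact: (svalP (cid graph_corr_mor_ex)).2. Qed.

End push.

Lemma graph_corr_mor_id E :
  graph_corr_mor (graph_id E) = corr_id (graph_corr (R := R) E).
Proof. exact: graph_corr_morP. Qed.

Lemma graph_corr_mor_comp E F G (g : graph_mor F G) (f : graph_mor E F) :
  graph_corr_mor (graph_comp g f) =
  corr_comp (graph_corr_mor g) (graph_corr_mor f).
Proof. by apply: graph_corr_morP => e /=; rewrite !graph_corr_mor_chi. Qed.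

End gamma.

Definition Gamma (R : realType) (V : countType) (U : choiceType) :
    functor (graph_category V U) (corr_category R V (domfun R U)) :=
  @Functor (graph_category V U) (corr_category R V (domfun R U))
    (@graph_corr R V U) (@graph_corr_mor R V U)
    (@graph_corr_mor_id R V U) (@graph_corr_mor_comp R V U).

(* Main.v *)
(** The vertices are recovered from the module actions: [rng e] is the only [v]
    for which the indicator [delta v] can fix on the left a function that does
    not vanish at [e], and likewise for [src e] on the right. Every function in
    the range of [Gamma phi] vanishes off the range of [phi], so [phi] is
    surjective on edges as soon as every [chi e] lies in the range of
    [Gamma phi]. *)
Require Import Defs.
From mathcomp Require Import all_boot all_order all_algebra.
From mathcomp Require Import reals.
From mathcomp Require Import complex boolp classical_sets functions cardinality.

Set Implicit Arguments.
Unset Strict Implicit.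
Unset Printing Implicit Defensive.

Import GRing.Theory.

Local Open Scope classical_set_scope.
Local Open Scope ring_scope.

Section recover_graph.
Context {R : realType} {V : countType} {U : choiceType}.
Implicit Types (E F : digraph V U) (X Y : corr_data R V (domfun R U)).
Implicit Types (v : V) (w : domfun R U).

Lemma vanishes_delta v :
  vanishes_at_infinity (fun u : V => (u == v)%:R : R[i]).
Proof.
apply: vanishes_finite; apply: (sub_finite_set _ (finite_set1 v)) => u /=.
by case: eqP.
Qed.

Definition delta v : c0 R V := mkc0 (vanishes_delta v).

(* The fixed vectors are described by elements of the ambient type, so that the
   predicates can be compared along an equality [X = Y]. *)
Definition lact_fixed X v w := exists2 x : X, sval x = w & lact (delta v) x = x.
Definition ract_fixed X v w := exists2 x : X, sval x = w & ract x (delta v) = x.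

Lemma chi_fun_neq0 E (e : E) : chi_fun (R := R) e e != 0.
Proof. by rewrite /chi_fun eqxx oner_neq0. Qed.

Lemma lact_fixed_chi E (e : E) :
  lact_fixed (graph_data E) (rng e) (existT _ (edges E) (chi_fun e)).
Proof.
exists (chi e); first by rewrite fun_ofE fun_of_chi.
apply: fun_of_ext => e'; rewrite fun_of_lact fun_of_chi /chi_fun /=.
by have [->|_] := eqVneq e' e; rewrite ?eqxx ?mulr1 ?mulr0.
Qed.

Lemma ract_fixed_chi E (e : E) :
  ract_fixed (graph_data E) (src e) (existT _ (edges E) (chi_fun e)).
Proof.
exists (chi e); first by rewrite fun_ofE fun_of_chi.
apply: fun_of_ext => e'; rewrite fun_of_ract fun_of_chi /chi_fun /=.
by have [->|_] := eqVneq e' e; rewrite ?eqxx ?mul1r ?mul0r.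
Qed.

(** Evaluated at [e], the fixed-point equation reads [delta v (rng e) * f e = f e], and [delta v]
    vanishes off [v]. *)
Lemma lact_fixed_rng E v (f : E -> R[i]) (e : E) : f e != 0 ->
  lact_fixed (graph_data E) v (existT _ (edges E) f) -> rng e = v.
Proof.
move=> fe [x xf] /(congr1 (fun y => fun_of y e)).
have -> : fun_of (lact (delta v) x) e = delta v (rng e) * fun_of x e.
  by rewrite fun_of_lact.
have -> : fun_of x = f by apply: existT_domfun_inj; rewrite -fun_ofE.
by rewrite /=; case: eqP => // _ /esym/eqP; rewrite mul0r (negbTE fe).
Qed.

Lemma ract_fixed_src E v (f : E -> R[i]) (e : E) : f e != 0 ->
  ract_fixed (graph_data E) v (existT _ (edges E) f) -> src e = v.
Proof.
move=> fe [x xf] /(congr1 (fun y => fun_of y e)).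
have -> : fun_of (ract x (delta v)) e = fun_of x e * delta v (src e).
  by rewrite fun_of_ract.
have -> : fun_of x = f by apply: existT_domfun_inj; rewrite -fun_ofE.
by rewrite /=; case: eqP => // _ /esym/eqP; rewrite mulr0 (negbTE fe).
Qed.

(** The zero function lies in [graph_carrier E] even when [E] has no edges, and the domain it
    carries is the edge set. *)
Lemma edges_graph_data E F :
  graph_data (R := R) E = graph_data F -> edges E = edges F.
Proof.
move=> EF.
have : graph_carrier F (existT _ (edges E) (fun=> 0 : R[i])).
  have <- : graph_carrier E = graph_carrier F := congr1 (@carrier _ _ _) EF.
  by exists (fun=> 0) => //; exact: in_graph_corr0.
by case=> f _ /(congr1 (@projT1 _ _)).
Qed.

Lemma graph_data_inj : injective (@graph_data R V U).
Proof.
move=> E F EF; have := edges_graph_data EF.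
case: E F EF => [A rE sE cE] [B rF sF cF] EF /= AB.
(* Once the edge sets are identified, the range and source maps have the same types and can be
   compared pointwise. *)
case: _ / AB in rF sF cF EF *.
have rEF : rE = rF.
  (* Carried along [EF], the function [chi_fun e] is fixed by [delta (rE e)] in the second
     correspondence too, whence [rF e = rE e]. *)
  apply/funext => e; have := @lact_fixed_chi (Digraph rE sE cE) e.
  by rewrite EF => /(@lact_fixed_rng (Digraph rF sF cF) _ _ e (chi_fun_neq0 _)).
have sEF : sE = sF.
  apply/funext => e; have := @ract_fixed_chi (Digraph rE sE cE) e.
  by rewrite EF => /(@ract_fixed_src (Digraph rF sF cF) _ _ e (chi_fun_neq0 _)).
by rewrite rEF sEF; congr Digraph; exact: Prop_irrelevance.
Qed.

End recover_graph.

Section isomorphism_reflection.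
Context {R : realType} {V : countType} {U : choiceType}.
Variables (E F : digraph V U) (phi : graph_mor E F).

(** Being determined by its values on the [chi e], the morphism is extension by zero along [phi]. *)
Lemma fun_of_graph_corr_mor (x : graph_corr (R := R) E) :
  fun_of (graph_corr_mor phi x) = push phi (fun_of x).
Proof. by rewrite (graph_corr_morP (push_chi phi)) fun_of_push. Qed.

(** A section [g] of [phi] is injective, and it preserves range and source because [phi] does. *)
Lemma graph_mor_surj_iso : (forall e', exists e, phi e = e') ->
  @isomorphism (graph_category V U) E F phi.
Proof.
move=> /choice[g phig].
have g_inj : injective g := can_inj phig.
have g_rng e' : rng (g e') = rng e' by rewrite -{2}(phig e') gmor_rng.
have g_src e' : src (g e') = src e' by rewrite -{2}(phig e') gmor_src.
exists (GraphMor g_inj g_rng g_src); split; apply: graph_mor_ext => e //=.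
(* Injectivity of [phi] turns [phi (g (phi e)) = phi e] into [g (phi e) = e]. *)
exact/(@gmor_inj _ _ _ _ phi)/phig.
Qed.

Lemma graph_corr_mor_surj :
  (forall y : graph_corr (R := R) F, exists x, graph_corr_mor phi x = y) ->
  forall e', exists e, phi e = e'.
Proof.
move=> surj e'; apply: contrapT => ne.
have [x /(congr1 (fun y => fun_of y e'))] := surj (chi e').
rewrite fun_of_graph_corr_mor push0 => [|e ee']; last by apply: ne; exists e.
by rewrite fun_of_chi /chi_fun eqxx => /esym/eqP; rewrite oner_eq0.
Qed.

End isomorphism_reflection.

Theorem theorem2p2 (R : realType) (V : countType) (U : choiceType)
    (E F : graph_category V U) :
  (Gamma R V U E = Gamma R V U F -> E = F) /\
  (forall phi : mor E F,
     isomorphism (fmor (Gamma R V U) phi) -> isomorphism phi).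
Proof.
split=> [/(congr1 (@corr _ _ _))/graph_data_inj//|phi [g [_ phig]]].
(* The inverse [g] of [Gamma phi] supplies the preimage of [y]. *)
apply/graph_mor_surj_iso/(@graph_corr_mor_surj R) => y; exists (g y).
exact: (congr1 (fun h : corr_mor (graph_corr F) (graph_corr F) => h y) phig).
Qed.
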